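(* $\mathfrak{Dau}(L_1(\{0,1\}^\kappa))=\kappa$ for every infinite cardinal $\kappa$.
   Context: All Banach spaces are real. $\{0,1\}^\kappa$ carries the product probability measure of the uniform measures on $\{0,1\}$. $B_X$ and $S_X$ denote the closed unit ball and unit sphere of a Banach space $X$. A slice of $B_X$ is a nonempty intersection of $B_X$ with an open half-space, i.e. a set $\{x\in B_X: f(x)>\sup f(B_X)-\alpha\}$ with $f\in X^*$, $\alpha>0$. For a cardinal $\kappa$, $\{y_\alpha:\alpha<\kappa\}$ denotes a set of cardinality at most $\kappa$. $X$ has the $\kappa$-Daugavet property if for every family $\{y_\alpha:\alpha<\kappa\}\subseteq S_X$, every slice $S$ of $B_X$ and every $\varepsilon>0$ there is $x\in S$ with $\|y_\alpha+x\|>2-\varepsilon$ for all $\alpha<\kappa$. For nonzero $X$, $\mathfrak{Dau}(X)$ is the least cardinal $\kappa$ such that $X$ fails the $\kappa$-Daugavet property. *)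

(* Defs.v *)
From HB Require Import structures.
From mathcomp Require Import all_boot all_order all_algebra finmap.
From mathcomp Require Import all_classical all_reals all_analysis.
From mathcomp Require Import measurable_realfun ess_sup_inf.
From mathcomp Require Import ring lra.

Set Implicit Arguments.
Unset Strict Implicit.
Unset Printing Implicit Defensive.

Import Order.TTheory GRing.Theory Num.Theory.
Import numFieldNormedType.Exports.

Local Open Scope classical_set_scope.
Local Open Scope ring_scope.
Local Open Scope quotient_scope.
Local Open Scope card_scope.

(* The library's LspaceType is the set of a.e.-classes of functions with finite
   L^p norm, without algebraic structure; it is made a normed space here. *)
Section lspace_normedmodule.
Context d (T : measurableType d) (R : realType).
Variables (mu : {measure set T -> \bar R}) (p : \bar R) (p1 : (1 <= p)%E).
Local Notation Lp := (LspaceType mu p1).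
Local Notation Lf := (LfunType mu p1).

Local Notation TR := (measurableTypeR R).

(* R and measurableTypeR R carry the same sigma-algebra, under distinct
   displays. *)
Definition mfunR (f : {mfun T >-> TR}) : {mfun T >-> R} :=
  MeasurableFun.Pack (MeasurableFun.Class (isMeasurableFun.Build d _ T R f
    (@measurable_funPT _ _ T TR f))).

Definition mfunTR (f : {mfun T >-> R}) : {mfun T >-> TR} :=
  MeasurableFun.Pack (MeasurableFun.Class (isMeasurableFun.Build d _ T TR f
    (@measurable_funPT _ _ T R f))).

Lemma Lspace_repr_subproof (u : Lp) : (u : T -> R) \in Lfun mu p.
Proof.
apply/andP; split; last by rewrite inE; exact: Lebesgue_finite.
exact: (valP (mfunR (repr (u : {mfun_ mu, T >-> TR})))).
Qed.

Definition Lspace_repr (u : Lp) : Lf := Lfun_Sub p1 (Lspace_repr_subproof u).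

Lemma ae_eq_Lnorm (f g : {mfun T >-> R}) : f = g %[ae mu] ->
  ('N[mu]_p[EFin \o f] = 'N[mu]_p[EFin \o g])%E.
Proof.
move=> fg; rewrite Lnorm.unlock; case: p p1 => [r _|_|]; last by [].
  have mE (h : {mfun T >-> R}) :
      measurable_fun [set: T] (fun x => `|(EFin \o h) x| `^ r : \bar R)%E.
    apply: (measurableT_comp (measurable_poweR _)).
    by apply: measurableT_comp => //; exact/measurable_EFinP.
  apply: (congr1 (fun x : \bar R => x `^ r^-1)%E).
  apply: ge0_ae_eq_integral.
  - by [].
  - exact: mE.
  - exact: mE.
  - by move=> x _; exact: poweR_ge0.
  - by move=> x _; exact: poweR_ge0.
  - by apply: filterS fg => x /= /[apply] ->.
case: ifPn => [_|_]; last by []; apply: eq_ess_sup.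
by apply: filterS fg => x /= /(_ I) ->.
Qed.

Local Notation piQ := (\pi_{mfun_ mu, T >-> TR}).

Lemma repr_pi_ae (f : {mfun T >-> R}) :
  (repr (piQ (mfunTR f)) : T -> R) = f %[ae mu].
Proof.
have : piQ (repr (piQ (mfunTR f))) == piQ (mfunTR f) by rewrite reprK.
by rewrite eqmodE => /asboolP.
Qed.

Lemma Lspace_pi_subproof (f : Lf) : 
  finite_norm mu p ((piQ (mfunTR f) : {mfun_ mu, T >-> TR}) : T -> R).
Proof.
rewrite /finite_norm.
rewrite (@ae_eq_Lnorm (mfunR (repr (piQ (mfunTR f)))) f (repr_pi_ae f)).
exact: Lfunction_finite.
Qed.

Definition Lspace_pi (f : Lf) : Lp :=
  LebesgueSpace.Pack (LebesgueSpace.Class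
    (isFinLebesgue.Build d T R mu p p1 _ (Lspace_pi_subproof f))).

Lemma Lspace_val_inj (u v : Lp) : (u : {mfun_ mu, T >-> TR}) = v -> u = v.
Proof.
case: u v => [u [[hu]]] [v [[hv]]] /= uv; rewrite uv in hu *.
by rewrite (Prop_irrelevance hu hv).
Qed.

Lemma Lspace_piP (f g : Lf) :
  Lspace_pi f = Lspace_pi g <-> (f : T -> R) = g %[ae mu].
Proof.
split=> [/(congr1 (fun u : Lp => (u : {mfun_ mu, T >-> TR})))/=/eqP|fg].
  by rewrite eqmodE => /asboolP.
by apply: Lspace_val_inj => /=; apply/eqP; rewrite eqmodE; exact/asboolP.
Qed.

Lemma Lspace_reprK : cancel Lspace_repr Lspace_pi.
Proof.
move=> u; apply: Lspace_val_inj => /=.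
apply/eqP; rewrite -[eqbRHS]reprK eqmodE; apply/asboolP.
exact: ae_eq_refl.
Qed.

Lemma Lspace_piK (f : Lf) : (Lspace_repr (Lspace_pi f) : T -> R) = f %[ae mu].
Proof. exact: repr_pi_ae. Qed.

Lemma Lspace_eqP (u v : Lp) : u = v <->
  (Lspace_repr u : T -> R) = Lspace_repr v %[ae mu].
Proof. by rewrite -Lspace_piP !Lspace_reprK. Qed.

HB.instance Definition _ := gen_eqMixin Lp.
HB.instance Definition _ := gen_choiceMixin Lp.

Definition Lspace_zero : Lp := Lspace_pi 0.
Definition Lspace_opp (u : Lp) : Lp := Lspace_pi (- Lspace_repr u).
Definition Lspace_add (u v : Lp) : Lp :=
  Lspace_pi (Lspace_repr u + Lspace_repr v).
Definition Lspace_scale (a : R) (u : Lp) : Lp := Lspace_pi (a *: Lspace_repr u).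
Definition Lspace_norm (u : Lp) : R := fine ('N[mu]_p[EFin \o Lspace_repr u])%E.

Lemma Lspace_addE (f g : Lf) :
  Lspace_add (Lspace_pi f) (Lspace_pi g) = Lspace_pi (f + g).
Proof.
apply/Lspace_piP; have := Lspace_piK f; have := Lspace_piK g.
apply: filterS2 => x gx fx _.
change (Lspace_repr (Lspace_pi f) x + Lspace_repr (Lspace_pi g) x = f x + g x).
by rewrite (fx I) (gx I).
Qed.

Lemma Lspace_oppE (f : Lf) : Lspace_opp (Lspace_pi f) = Lspace_pi (- f).
Proof.
apply/Lspace_piP; have := Lspace_piK f.
apply: filterS => x fx _.
by change (- Lspace_repr (Lspace_pi f) x = - f x); rewrite (fx I).
Qed.

Lemma Lspace_scaleE a (f : Lf) :
  Lspace_scale a (Lspace_pi f) = Lspace_pi (a *: f).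
Proof.
apply/Lspace_piP; have := Lspace_piK f.
apply: filterS => x fx _.
by change (a * Lspace_repr (Lspace_pi f) x = a * f x); rewrite (fx I).
Qed.

Lemma Lspace_normE (f : Lf) :
  Lspace_norm (Lspace_pi f) = fine ('N[mu]_p[EFin \o f])%E.
Proof. by congr fine; apply: ae_eq_Lnorm; exact: Lspace_piK. Qed.

Fact Lspace_addA : associative Lspace_add.
Proof.
move=> u v w; rewrite -[u]Lspace_reprK -[v]Lspace_reprK -[w]Lspace_reprK.
by rewrite !Lspace_addE addrA.
Qed.

Fact Lspace_addC : commutative Lspace_add.
Proof. by move=> u v; rewrite /Lspace_add addrC. Qed.

Fact Lspace_add0 : left_id Lspace_zero Lspace_add.
Proof.
by move=> u; rewrite -[u]Lspace_reprK /Lspace_zero Lspace_addE add0r.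
Qed.

Fact Lspace_addN : left_inverse Lspace_zero Lspace_opp Lspace_add.
Proof.
by move=> u; rewrite -[u]Lspace_reprK Lspace_oppE Lspace_addE addNr.
Qed.

HB.instance Definition _ := GRing.isZmodule.Build Lp
  Lspace_addA Lspace_addC Lspace_add0 Lspace_addN.

Lemma Lspace_piD (f g : Lf) : Lspace_pi (f + g) = Lspace_pi f + Lspace_pi g.
Proof. by rewrite -Lspace_addE. Qed.

Fact Lspace_scaleA a b u :
  Lspace_scale a (Lspace_scale b u) = Lspace_scale (a * b) u.
Proof. by rewrite -[u]Lspace_reprK !Lspace_scaleE scalerA. Qed.

Fact Lspace_scale1 : left_id 1 Lspace_scale.
Proof. by move=> u; rewrite -[u]Lspace_reprK Lspace_scaleE scale1r. Qed.

Fact Lspace_scaleDr : right_distributive Lspace_scale +%R.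
Proof.
move=> a u v; rewrite -[u]Lspace_reprK -[v]Lspace_reprK.
by rewrite -Lspace_piD !Lspace_scaleE -Lspace_piD scalerDr.
Qed.

Fact Lspace_scaleDl u : {morph Lspace_scale^~ u : a b / a + b}.
Proof.
move=> a b; rewrite -[u]Lspace_reprK.
by rewrite !Lspace_scaleE -Lspace_piD scalerDl.
Qed.

HB.instance Definition _ := GRing.Zmodule_isLmodule.Build R Lp
  Lspace_scaleA Lspace_scale1 Lspace_scaleDr Lspace_scaleDl.

Fact Lspace_normD u v : Lspace_norm (u + v) <= Lspace_norm u + Lspace_norm v.
Proof.
rewrite -[u]Lspace_reprK -[v]Lspace_reprK -Lspace_piD !Lspace_normE.
exact: ler_LnormD.
Qed.

Fact Lspace_normZ a u : Lspace_norm (a *: u) = `|a| * Lspace_norm u.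
Proof.
rewrite -[u]Lspace_reprK [a *: _]Lspace_scaleE !Lspace_normE.
apply: EFin_inj; rewrite EFinM !finite_norm_fine.
exact: LnormZ.
Qed.

Fact Lspace_norm0_eq0 u : Lspace_norm u = 0 -> u = 0.
Proof.
move=> u0; apply/Lspace_eqP.
apply: ae_eq_trans (fine_Lnormr_eq0 u0) _.
exact/ae_eq_sym/Lspace_piK.
Qed.

HB.instance Definition _ := Lmodule_isNormed.Build R Lp
  Lspace_normD Lspace_normZ Lspace_norm0_eq0.

End lspace_normedmodule.

Lemma Lspace1_normE d (T : measurableType d) (R : realType)
    (mu : {measure set T -> \bar R}) (u : LspaceType1 mu) :
  (`|u|%:E = \int[mu]_x `|(Lspace_repr u x)%:E|)%E.
Proof. by rewrite /Num.norm /= finite_norm_fine Lnorm1. Qed.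

Section cube.
Variable K : choiceType.

Definition cube : Type := K -> bool.
HB.instance Definition _ := Pointed.copy cube (K -> bool).
HB.instance Definition _ :=
  Topological.copy cube (prod_topology (fun _ : K => bool)).

Definition supported (U : Type) (s : seq K) (f : cube -> U) :=
  forall x y : cube, {in s, x =1 y} -> f x = f y.

Definition cylinder : set (set cube) := [set A | exists s, supported s A].

Lemma supportedW (U : Type) (s s' : seq K) (f : cube -> U) :
  {subset s <= s'} -> supported s f -> supported s' f.
Proof. by move=> ss' fs x y xy; apply: fs => i /ss'; exact: xy. Qed.

Lemma cylinder0 : cylinder set0.
Proof. by exists [::]. Qed.

Lemma cylinderU : setU_closed cylinder.
Proof.
move=> A B [s As] [s' Bs']; exists (s ++ s') => x y xy; rewrite /setU /mkset.
congr (_ \/ _).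
  by apply: As => i si; apply: xy; rewrite mem_cat si.
by apply: Bs' => i si; apply: xy; rewrite mem_cat si orbT.
Qed.

Lemma cylinderC : setC_closed cylinder.
Proof.
by move=> A [s As]; exists s => x y xy; rewrite /setC /mkset (As _ _ xy).
Qed.

Definition cylinder_display : measure_display.
Proof. exact. Qed.

HB.instance Definition _ := isAlgebraOfSets.Build cylinder_display cube
  cylinder0 cylinderU cylinderC.

Lemma cylinder_open (A : set cube) : cylinder A ->
  open A.
Proof.
move=> [s As]; rewrite openE => x Ax.
pose V := \bigcap_(i in [set` s]) [set y : cube | y i = x i].
have : nbhs x V.
  rewrite /V; elim: (s) => [|i r ih].
    by apply: filterS filterT => y _ i.
  have -> : \bigcap_(j in [set` i :: r]) [set y : cube | y j = x j] =
    [set y : cube | y i = x i] `&` \bigcap_(j in [set` r]) [set y | y j = x j].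
    apply/seteqP; split => y /=.
      move=> yx; split=> [|j jr]; apply: yx => /=; rewrite inE ?eqxx//.
      by rewrite jr orbT.
    by move=> [yi yr] j /=; rewrite inE => /predU1P[->//|]; exact: yr.
  apply: filterI => //.
  have := @proj_continuous K (fun _ => bool) i x [set b | b = x i].
  by apply; exact: discrete_set1.
by apply: filterS => y Vy /=; rewrite (As y x) // => i si; exact: Vy.
Qed.

Lemma cube_compact : compact [set: cube].
Proof.
have := @tychonoff K (fun _ => bool) (fun _ => setT) (fun _ => bool_compact).
by congr compact; apply/seteqP; split.
Qed.

Lemma cylinder_bigcup_finite (F : (set cube)^nat) :
  (forall n, cylinder (F n)) -> trivIset setT F -> cylinder (\bigcup_n F n) ->
  exists N, forall n, (N <= n)%N -> F n = set0.
Proof.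
move=> cF tF cUF.
pose G (o : option nat) := if o is Some n then F n else ~` (\bigcup_n F n).
have := cube_compact; rewrite compact_cover => /(_ (option nat) setT G).
case.
- by move=> [n|] _ /=; apply: cylinder_open; [exact: cF|exact: cylinderC].
- move=> x _; have [[n _ Fnx]|nx] := pselect ((\bigcup_n F n) x).
    by exists (Some n).
  by exists None.
move=> D _ covD.
exists (\max_(o <- enum_fset D) (if o is Some n then n.+1 else 0))%N => n Nn.
rewrite -subset0 => x Fnx.
have [[m|] /= mD Gx] := covD x I; last by apply: Gx; exists n.
have mn : (m < n)%N.
  apply: leq_trans Nn.
  by rewrite (big_rem (Some m)) //= leq_max leqnn.
have : (F m `&` F n) !=set0 by exists x.
by move=> /(tF m n I I) mnE; rewrite mnE ltnn in mn.
Qed.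

End cube.

Section mean.
Variables (R : realType) (K : choiceType).
Local Notation cube := (cube K).
Implicit Types (f g : cube -> R) (s : seq K).

Definition upd (x : cube) (i : K) (b : bool) : cube :=
  fun j => if j == i then b else x j.

Definition avg (i : K) (f : cube -> R) (x : cube) : R :=
  2^-1 * (f (upd x i true) + f (upd x i false)).

Fixpoint mean s f : cube -> R := if s is i :: s' then mean s' (avg i f) else f.

Lemma avgC i j f : avg i (avg j f) = avg j (avg i f).
Proof.
apply/funext => x; rewrite /avg.
have [->//|ij] := eqVneq i j.
have uE a b : upd (upd x i a) j b = upd (upd x j b) i a.
  apply/funext => k; rewrite /upd.
  by have [->|//] := eqVneq k j; rewrite eq_sym (negbTE ij).
by rewrite !uE; ring.
Qed.

Lemma mean_avg s i f : mean s (avg i f) = avg i (mean s f).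
Proof. by elim: s f => //= j s ih f; rewrite avgC ih. Qed.

Lemma mean_mean s s' f : mean s (mean s' f) = mean s' (mean s f).
Proof. by elim: s f => //= j s ih f; rewrite -mean_avg ih. Qed.

Lemma mean_const s f : supported [::] f -> mean s f = f.
Proof.
elim: s f => //= i s ih f f0; rewrite ih; last first.
  by move=> x y _; rewrite /avg; congr (_ * (_ + _)); apply: f0.
apply/funext => x; rewrite /avg (f0 (upd x i true) x)//.
by rewrite (f0 (upd x i false) x)//; field.
Qed.

Lemma mean_supported s f : supported s f -> supported [::] (mean s f).
Proof.
elim: s f => //= i s ih f fs; apply: ih => x y xy.
rewrite /avg; congr (_ * (_ + _)); apply: fs => j; rewrite inE /upd;
  by case: eqP => //= _; exact: xy.
Qed.

Lemma mean_indep s s' f :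
  supported s f -> supported s' f -> mean s f = mean s' f.
Proof.
move=> fs fs'; rewrite -(mean_const s' (mean_supported fs)).
by rewrite mean_mean (mean_const s (mean_supported fs')).
Qed.

Lemma meanD s f g x : mean s (f \+ g) x = mean s f x + mean s g x.
Proof.
elim: s f g => //= i s ih f g; rewrite -ih; congr (mean s _ x).
by apply/funext => y; rewrite /avg /=; ring.
Qed.

Lemma mean_ge0 s f x : (forall y, 0 <= f y) -> 0 <= mean s f x.
Proof.
elim: s f => //= i s ih f f0; apply: ih => y.
by rewrite /avg mulr_ge0// addr_ge0.
Qed.

Lemma meanZ s c f x : mean s (fun y => c * f y) x = c * mean s f x.
Proof.
elim: s f => //= i s ih f; rewrite -ih; congr (mean s _ x).
by apply/funext => y; rewrite /avg; ring.
Qed.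

Lemma mean_prod s (g : K -> bool -> R) x : uniq s ->
  mean s (fun y => \prod_(i <- s) g i (y i)) x =
  \prod_(i <- s) (2^-1 * (g i true + g i false)).
Proof.
elim: s => [|i s ih] /=; first by rewrite !big_nil.
move=> /andP[si us]; rewrite big_cons -ih//.
pose c := 2^-1 * (g i true + g i false).
have -> : avg i (fun y => \prod_(i0 <- i :: s) g i0 (y i0)) =
    (fun y => c * \prod_(i0 <- s) g i0 (y i0)).
  apply/funext => y; rewrite /avg !big_cons /upd eqxx.
  have gE b : \prod_(j <- s) g j (if j == i then b else y j) =
      \prod_(j <- s) g j (y j).
    apply: eq_big_seq => j js; case: eqP => // ji.
    by rewrite -ji js in si.
  by rewrite !gE /c; ring.
exact: meanZ.
Qed.

(* By mean_indep, the value does not depend on the chosen support. *)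
Definition cyl_support (A : set cube) : seq K :=
  xget [::] [set s | supported s A].

Definition cylinder_measure (A : set cube) : \bar R :=
  (mean (cyl_support A) \1_A point)%:E.

Lemma supported_indic s (A : set cube) :
  supported s A -> supported s (\1_A : cube -> R).
Proof.
move=> As x y xy; rewrite !indicE; congr (nat_of_bool _)%:R.
by apply/idP/idP; rewrite !inE (As _ _ xy).
Qed.

Lemma cylinder_measureE s (A : set cube) :
  supported s A -> cylinder_measure A = (mean s \1_A point)%:E.
Proof.
move=> As; rewrite /cylinder_measure; congr (_%:E).
rewrite (@mean_indep _ s)//; last exact: supported_indic.
apply: supported_indic.
by rewrite /cyl_support; case: xgetP => [_ -> //|/(_ s)].
Qed.

Lemma cylinder_measure0 : cylinder_measure set0 = 0%E.
Proof. by rewrite (@cylinder_measureE [::])//= indicE in_set0. Qed.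

Lemma cylinder_measureT : cylinder_measure setT = 1%E.
Proof. by rewrite (@cylinder_measureE [::])//= indicE in_setT. Qed.

Lemma cylinder_measure_ge0 A : (0 <= cylinder_measure A)%E.
Proof. by rewrite lee_fin mean_ge0// => y; rewrite indicE. Qed.

Lemma cylinder_measureU : semi_additive2 cylinder_measure.
Proof.
move=> A B [s As] [s' Bs'] _ AB0.
have As2 : supported (s ++ s') A.
  by apply: supportedW As => i si; rewrite mem_cat si.
have Bs2 : supported (s ++ s') B.
  by apply: supportedW Bs' => i si; rewrite mem_cat si orbT.
have ABs : supported (s ++ s') (A `|` B).
  by move=> x y xy; rewrite /setU /mkset (As2 _ _ xy) (Bs2 _ _ xy).
rewrite !(@cylinder_measureE (s ++ s'))// -EFinD -meanD; congr (_%:E).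
congr (mean _ _ _); apply/funext => x /=; rewrite !indicE in_setU.
have [xA|//] := boolP (x \in A); last by rewrite add0r.
rewrite (_ : (x \in B) = false) ?addr0//; apply/negP; rewrite inE => xB.
by move: xA; rewrite inE => xA; have : (A `&` B) x by []; rewrite AB0.
Qed.

Lemma cylinder_measure_semi_additive :
  measure_function.semi_additive cylinder_measure.
Proof.
apply/additive2P; first exact: cylinder_measure0.
by rewrite -semi_additive2E; exact: cylinder_measureU.
Qed.

Lemma cylinder_measure_semi_sigma_additive :
  semi_sigma_additive cylinder_measure.
Proof.
move=> F mF tF mUF; have [N FN] := cylinder_bigcup_finite mF tF mUF.
have -> : \bigcup_n F n = \big[setU/set0]_(i < N) F i.
  rewrite -bigcup_mkord; apply/seteqP; split => x [n nN Fnx]; exists n => //=.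
  by rewrite ltnNge; apply/negP => /FN Fn0; rewrite Fn0 in Fnx.
rewrite cylinder_measure_semi_additive//; last exact: bigsetU_measurable.
apply: cvg_near_cst; near=> n.
have Nn : (N <= n)%N by near: n; exists N.
rewrite -(big_mkord xpredT (fun i => cylinder_measure (F i))).
rewrite (@big_cat_nat _ _ _ N)//=.
have -> : (\sum_(N <= i < n) cylinder_measure (F i) = 0)%E.
  rewrite big_nat_cond big1// => i /andP[/andP[Ni _] _].
  by rewrite FN// cylinder_measure0.
by rewrite adde0 big_mkord.
Unshelve. all: by end_near. Qed.

HB.instance Definition _ := isMeasure.Build _ _ _ cylinder_measure
  cylinder_measure0 cylinder_measure_ge0 cylinder_measure_semi_sigma_additive.

(* The product sigma-algebra on {0,1}^K. *)
Definition measurable_cube : measurableType _ :=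
  g_sigma_algebraType (@measurable _ cube).

(* The product of the uniform measures on {0,1}: see coin_prod. *)
Definition coin : set measurable_cube -> \bar R :=
  measure_extension cylinder_measure.

HB.instance Definition _ := Measure.on coin.

Lemma coin_cylinder (A : set cube) : cylinder A -> coin A = cylinder_measure A.
Proof. by move=> cA; rewrite /coin /measure_extension measurable_mu_extE. Qed.

Lemma coin_setT : coin setT = 1%E.
Proof. by rewrite coin_cylinder ?cylinder_measureT//; exists [::]. Qed.

HB.instance Definition _ := Measure_isProbability.Build _ _ R coin coin_setT.

Lemma coin_prod (s : seq K) (A : K -> set bool) : uniq s ->
  coin [set x : cube | forall i, i \in s -> A i (x i)] =
  (\prod_(i <- s) bernoulli_prob 2^-1 (A i))%E.
Proof.
move=> us.
have ss : supported s [set x : cube | forall i, i \in s -> A i (x i)].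
  move=> x y xy; apply/propext; split=> h i si.
    by rewrite -xy//; exact: h.
  by rewrite xy//; exact: h.
rewrite coin_cylinder; last by exists s.
rewrite (cylinder_measureE ss).
have -> : \1_[set x : cube | forall i, i \in s -> A i (x i)] =
    (fun x : cube => \prod_(i <- s) (\1_(A i) (x i))) :> (cube -> R).
  apply/funext => x; rewrite indicE.
  have [h|h] := pselect (forall i, i \in s -> A i (x i)).
    rewrite mem_set//; apply/esym.
    by rewrite big_seq big1// => i si; rewrite indicE mem_set//; exact: h.
  rewrite memNset//; have [i [si nAi]] : exists i, i \in s /\ ~ A i (x i).
    apply: contrapT => nex; apply: h => i si; apply: contrapT => nA.
    by apply: nex; exists i.
  by rewrite (big_rem i)//= indicE memNset// mul0r.
rewrite (mean_prod (fun i b => \1_(A i) b))//.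
rewrite (big_morph EFin (@EFinM R) (erefl 1%:E)); apply: eq_bigr => i _.
rewrite bernoulli_probE; last by lra.
rewrite !diracE !indicE /unstable.onem -!EFinM -EFinD; congr (_%:E).
by field.
Qed.

End mean.

Section daugavet.
Variables (R : realType) (X : normedModType R).

Definition unit_ball : set X := [set x | `|x| <= 1].
Definition unit_sphere : set X := [set x | `|x| = 1].

Definition is_slice (S : set X) : Prop :=
  exists (f : {scalar X}) (a : R), [/\ continuous (f : X -> R), 0 < a &
    S = [set x | unit_ball x /\ sup (f @` unit_ball) - a < f x]].

(* The cardinal kappa is represented by a type J of that cardinality. *)
Definition daugavet_property (J : Type) : Prop :=
  forall Y : set X, Y `<=` unit_sphere -> Y #<= [set: J] ->
  forall S, is_slice S -> forall e : R, 0 < e ->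
  exists2 x, S x & forall y, Y y -> 2 - e < `|y + x|.

End daugavet.

(* The definition keeps K and J in one universe, so that J ranges over
   representatives of all cardinals below that of K. *)
Definition least_cardinal (P : Type -> Prop) (K : Type) : Prop :=
  P K /\ forall J : Type, P J -> [set: K] #<= [set: J].

(* is_Dau X K : the cardinal Dau(X) is the cardinality of K. *)
Definition is_Dau (R : realType) (X : normedModType R) (K : Type) : Prop :=
  least_cardinal (fun J => ~ daugavet_property X J) K.

(* L_1({0,1}^K) *)
Definition L1_cube (R : realType) (K : choiceType) : normedModType R :=
  LspaceType1 (@coin R K).

(* Main.v *)
Require Import Defs.
From mathcomp Require Import all_boot all_order all_algebra finmap.
From mathcomp Require Import all_classical all_reals all_analysis.
From mathcomp Require Import measurable_realfun ring lra.

Set Implicit Arguments.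
Unset Strict Implicit.
Unset Printing Implicit Defensive.

Import Order.TTheory GRing.Theory Num.Theory.
Import numFieldNormedType.Exports HBSimple.

Local Open Scope classical_set_scope.
Local Open Scope ring_scope.
Local Open Scope card_scope.

(* Functions depending on finitely many coordinates, with rational values, are
   dense in L_1({0,1}^K), and by Hessenberg's theorem there are at most |K| of
   them. Once normalised they defeat the slice that is the whole ball: a point x
   of the ball has one of them close to -x/|x|.
   Conversely, let Y be a set of fewer than |K| unit vectors. Each is close to a
   function of finitely many coordinates, so infinitely many coordinates are
   left free. Take a unit vector w of the slice that depends on finitely many
   coordinates; for a free coordinate i, w is the average of 2 1_{x_i = 0} w and
   2 1_{x_i = 1} w, which have norm one and one of which is again in the slice.
   After n free coordinates one reaches a vector living on a cell of measure
   2^-n that is independent of Y, hence almost disjoint from every y in Y. *)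

(** * Cardinals *)

(** Choice picks a partner for each [a], and left-uniqueness makes the choice injective. Graphs
    obtained from Zorn's lemma can thus be used directly. *)
Lemma card_le_rel T U (A : set T) (B : set U) (r : T -> U -> Prop) :
  (forall a, A a -> exists2 b, B b & r a b) ->
  (forall a a' b, A a -> A a' -> r a b -> r a' b -> a = a') ->
  A #<= B.
Proof.
move=> rtot rinj.
have [A0|nA0] := pselect (A = set0); first by rewrite A0.
have [a0 /rtot[b0 _ _]] : A !=set0 by apply/set0P/eqP.
have /choice[f fP] : forall a, exists b, A a -> B b /\ r a b.
  move=> a.
  have [/rtot[b Bb ab]|nAa] := pselect (A a); first by exists b.
  by exists b0.
have /injfunPex[g] : exists2 f : T -> U, set_fun A B f & set_inj A f.
  exists f => [a Aa|a a' /set_mem Aa /set_mem Aa' ff].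
    exact: (fP a Aa).1.
  apply: (rinj a a' (f a)) => //; first exact: (fP a Aa).2.
  by rewrite ff; exact: (fP a' Aa').2.
exact: inj_card_le g.
Qed.

Lemma card_le_fun T U (A : set T) (B : set U) (u0 : U) : A #<= B ->
  exists2 f : T -> U, set_fun A B f & set_inj A f.
Proof.
move=> /card_leP[f]; apply/injfunPex; squash (valLR u0 f).
Qed.

Lemma card_le_inj T U (A : set T) (B : set U) (f : T -> U) :
  set_fun A B f -> set_inj A f -> A #<= B.
Proof.
move=> fAB fi; apply: (@card_le_rel _ _ _ _ (fun a b => b = f a)).
  by move=> a Aa; exists (f a) => //; exact: fAB.
by move=> a a' b Aa Aa' -> ff; apply: fi; rewrite ?inE.
Qed.

(** Zorn's lemma on graphs of partial injections from [A] to [B]: a maximal one is total on [A] or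
    onto [B], since otherwise a pair of two missed points could be added. *)
Lemma card_le_total T U (A : set T) (B : set U) : A #<= B \/ B #<= A.
Proof.
pose P (G : set (T * U)) := [/\ G `<=` [set p | A p.1 /\ B p.2],
  forall a b b', G (a, b) -> G (a, b') -> b = b' &
  forall a a' b, G (a, b) -> G (a', b) -> a = a'].
have [|G [[GAB Gf Gi] Gmax]] := @Zorn_bigcup _ P.
  move=> F FP Ftot; split.
  - by move=> p [G /FP[+ _ _]]; exact.
  - move=> a b b' [G FG Gab] [G' FG' Gab'].
    by have [GG|GG] := Ftot _ _ FG FG';
      [have [_ + _] := FP _ FG'|have [_ + _] := FP _ FG]; apply; eauto.
  - move=> a a' b [G FG Gab] [G' FG' Gab'].
    by have [GG|GG] := Ftot _ _ FG FG';
      [have [_ _] := FP _ FG'|have [_ _] := FP _ FG]; apply; eauto.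
have [Adom|/existsNP[a /not_implyP[Aa nGa]]] :=
    pselect (forall a, A a -> exists b, G (a, b)).
  left; apply: (@card_le_rel _ _ _ _ (fun a b => G (a, b))).
    by move=> a /Adom[b Gab]; exists b => //; have [] := GAB _ Gab.
  by move=> a a' b _ _; exact: Gi.
right; apply: (@card_le_rel _ _ _ _ (fun b a => G (a, b))); last first.
  by move=> b b' a' _ _; exact: Gf.
move=> b Bb; apply: contrapT => nGb.
apply: (Gmax (G `|` [set (a, b)])).
  split; first by move=> p; left.
  by move=> /(_ (a, b) (or_intror erefl)) Gab; apply: nGa; exists b.
split.
- by move=> p [/GAB//|->].
- move=> x y y' /= [Gxy|[xa ->]] [Gxy'|[xa' ->]] //; first exact: Gf Gxy Gxy'.
    by exfalso; apply: nGa; exists y; rewrite -xa'.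
  by exfalso; apply: nGa; exists y'; rewrite -xa.
- move=> x x' y /= [Gxy|[-> yb]] [Gxy'|[-> yb']] //; first exact: Gi Gxy Gxy'.
    by exfalso; apply: nGb; exists x; [have [] := GAB _ Gxy|rewrite -yb'].
  by exfalso; apply: nGb; exists x'; [have [] := GAB _ Gxy'|rewrite -yb].
Qed.

Lemma card_le_nonempty T U (A : set T) (B : set U) :
  A #<= B -> A !=set0 -> B !=set0.
Proof.
move=> AB /set0P A0; apply/set0P; apply: contra A0 => /eqP B0.
by move: AB; rewrite B0 => /card_le0P ->.
Qed.

Lemma card_leX T U T' U' (A : set T) (B : set U) (A' : set T') (B' : set U') :
  A #<= A' -> B #<= B' -> A `*` B #<= A' `*` B'.
Proof.
have [A0|/eqP/set0P Aa] := pselect (A = set0); first by rewrite A0 set0X.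
have [B0|/eqP/set0P Bb] := pselect (B = set0); first by rewrite B0 setX0.
move=> AA' BB'.
have [a' _] := card_le_nonempty AA' Aa; have [b' _] := card_le_nonempty BB' Bb.
have [f fA fi] := card_le_fun a' AA'; have [g gB gi] := card_le_fun b' BB'.
apply: (@card_le_inj _ _ _ _ (fun p => (f p.1, g p.2))).
  by move=> [x y] [/= Ax By]; split => /=; [exact: fA|exact: gB].
move=> [x y] [x' y'] /set_mem[/= Ax By] /set_mem[/= Ax' By'] [ff gg].
by congr pair; [apply: fi|apply: gi]; rewrite ?inE.
Qed.

(** Two distinct points [c] and [d] of [C] serve as tags: the union embeds in the square of [C], the
    tag telling whether the point was coded through [A] or through [B]. *)
Lemma card_leU T U (A B : set T) (C : set U) :
  infinite_set C -> C `*` C #<= C -> A #<= C -> B #<= C -> A `|` B #<= C.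
Proof.
move=> Cinf CC AC BC; apply: card_le_trans CC.
have [c Cc] := infinite_setN0 Cinf.
have [d [Cd /= dc]] : (C `\` [set c]) !=set0.
  exact/infinite_setN0/infinite_setD.
have [f fA fi] := card_le_fun c AC; have [g gB gi] := card_le_fun c BC.
apply: (@card_le_inj _ _ _ _
  (fun x => if x \in A then (f x, c) else (g x, d))).
  move=> x ABx; case: ifPn => [/set_mem Ax|/negP/= nAx].
    by split => //; exact: fA.
  by case: ABx => [/mem_set//|Bx]; split => //; exact: gB.
move=> x y /set_mem ABx /set_mem ABy.
case: ifPn => [Ax|nAx]; case: ifPn => [Ay|nAy] //.
- by move=> [ff]; apply: fi.
- by move=> [_ cd]; rewrite cd in dc.
- by move=> [_ cd]; rewrite cd in dc.
- move=> [gg]; apply: gi => //; rewrite inE.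
    by case: ABx => // /mem_set; rewrite (negbTE nAx).
  by case: ABy => // /mem_set; rewrite (negbTE nAy).
Qed.

(** * Hessenberg's theorem on squares of infinite sets *)

Section square.
Variables (T : Type) (A : set T).

(** The domain is read off the diagonal, so that a graph carries its own [D] through Zorn's
    lemma. *)
Definition square_dom (G : set (T * T * T)) : set T :=
  [set a | exists c, G (a, a, c)].

(* A partial injection D x D -> D with D included in A is represented by its
   graph, a left-unique relation. *)
Definition square_graph (G : set (T * T * T)) :=
  [/\ square_dom G `<=` A,
    forall p c, G (p, c) ->
      [/\ square_dom G p.1, square_dom G p.2 & square_dom G c],
    forall a b, square_dom G a -> square_dom G b -> exists c, G (a, b, c) &
    forall p p' c, G (p, c) -> G (p', c) -> p = p'].

Lemma square_domS G G' : G `<=` G' -> square_dom G `<=` square_dom G'.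
Proof. by move=> GG' a [c /GG' Gc]; exists c. Qed.

(** Any two triples of the union lie in a common member of the chain, and each clause of
    [square_graph] involves at most two triples. *)
Lemma square_graph_bigcup (F : set (set (T * T * T))) :
  F `<=` square_graph -> total_on F subset ->
  square_graph (\bigcup_(G in F) G).
Proof.
move=> Fsq Ftot; set U := \bigcup_(G in F) G.
have U2 p q : U p -> U q -> exists G, [/\ F G, G p & G q].
  move=> [G FG Gp] [G' FG' Gq].
  by have [GG|GG] := Ftot _ _ FG FG'; [exists G'|exists G]; split; auto.
have domU G : F G -> square_dom G `<=` square_dom U.
  by move=> FG; apply: square_domS => p Gp; exists G.
split.
- by move=> a [c [G FG Gc]]; have [+ _ _ _] := Fsq _ FG; apply; exists c.
- move=> p c [G FG Gpc]; have [_ /(_ _ _ Gpc)[d1 d2 dc] _ _] := Fsq _ FG.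
  by split; apply: (domU _ FG).
- move=> a b [c Uc] [c' Uc']; have [G [FG Gc Gc']] := U2 _ _ Uc Uc'.
  have Ga : square_dom G a by exists c.
  have Gb : square_dom G b by exists c'.
  have [_ _ /(_ a b Ga Gb)[d Gd] _] := Fsq _ FG.
  by exists d, G.
- move=> p p' c Up Up'; have [G [FG Gp Gp']] := U2 _ _ Up Up'.
  by have [_ _ _] := Fsq _ FG; apply; eauto.
Qed.

(** A countably infinite starting point for Zorn's lemma: [choice.pickle] injects pairs of naturals
    into the naturals, and [e] carries this over to [A]. *)
Lemma square_graph_nat (e : nat -> T) : injective e -> (forall n, A (e n)) ->
  square_graph
    [set (e x.1, e x.2, e (choice.pickle x)) | x in [set: nat * nat]].
Proof.
move=> ei eA; set G := (X in square_graph X).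
have Ge n : square_dom G (e n) by exists (e (choice.pickle (n, n))), (n, n).
split.
- by move=> a [c [x _ [<- _ _]]].
- by move=> p c [x _ [<- <-]]; split; exact: Ge.
- move=> a b [c [x _ [<- _ _]]] [c' [x' _ [<- _ _]]].
  by exists (e (choice.pickle (x.1, x'.1))), (x.1, x'.1).
- move=> p p' c [x _ [<- <-]] [x' _ [<- /ei]].
  by move=> /(pcan_inj choice.pickleK) ->.
Qed.

(** The complement of [D] in [A] contains a copy [B] of [D], and the square of [D'], the union of
    [D] and [B], still embeds in [B]. The new pairs are sent into [B], where no old value lies. *)
Lemma square_graph_extend (G : set (T * T * T)) :
  infinite_set (square_dom G) -> square_graph G ->
  square_dom G #<= A `\` square_dom G ->
  exists2 G', square_graph G' & G `<` G'.
Proof.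
set D := square_dom G => Dinf [DA Gdom Gtot Ginj] DAD.
have DD : D `*` D #<= D.
  apply: (@card_le_rel _ _ _ _ (fun p c => G (p, c))).
    move=> [a b] [/= Da Db]; have [c Gc] := Gtot a b Da Db; exists c => //.
    by have [] := Gdom _ _ Gc.
  by move=> p p' c _ _; exact: Ginj.
have [d0 Dd0] := infinite_setN0 Dinf.
have [j jD ji] := card_le_fun d0 DAD.
pose B := j @` D; pose D' := D `|` B.
have nDB b : B b -> ~ D b by move=> [d /jD[_ nDd] <-].
have D'D' : D' `*` D' #<= B.
  have D'D : D' #<= D by apply: card_leU => //; exact: card_image_le.
  apply: card_le_trans (card_leX D'D D'D) _.
  apply: card_le_trans DD _; apply: (@card_le_inj _ _ _ _ j) => //.
  by move=> d Dd; exists d.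
have [f fB fi] := card_le_fun d0 D'D'.
pose G' := G `|` [set x | [/\ (D' `*` D') x.1, ~ (D `*` D) x.1 & x.2 = f x.1]].
have G'D : square_dom G' = D'.
  apply/seteqP; split=> a.
    by move=> [c [Gc|[[]//]]]; left; exists c.
  move=> [[c Gc]|Ba]; first by exists c; left.
  exists (f (a, a)); right; split => //=; first by split; right.
  by move=> [/= Da _]; exact: nDB Da.
exists G'.
  split; rewrite ?G'D.
  - by move=> a [/DA//|[d /jD[Ad _] <-]].
  - move=> p c [/Gdom[]|[/= pD _ ->]]; first by split; left.
    by split; [exact: pD.1|exact: pD.2|right; exact: fB].
  - move=> a b D'a D'b; have [[/= Da Db]|nD] := pselect ((D `*` D) (a, b)).
      by have [c Gc] := Gtot _ _ Da Db; exists c; left.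
    by exists (f (a, b)); right.
  - move=> p p' c [Gp|[/= pD _ ->]] [Gp'|[/= pD' _ fE]].
    + exact: Ginj Gp Gp'.
    + by have [_ _] := Gdom _ _ Gp; rewrite fE => /nDB[]; exact: fB.
    + by have [_ _] := Gdom _ _ Gp' => /nDB[]; exact: fB.
    + by apply: fi; rewrite ?inE.
split; first by move=> x; left.
move=> G'G; have : square_dom G' (j d0).
  by rewrite G'D; right; exists d0.
by move=> /(square_domS G'G); apply: nDB; exists d0.
Qed.

(** The domain of a maximal graph cannot be copied into its complement, so by comparability the
    complement embeds in the domain. Hence [A] itself embeds in the domain, whose square is
    absorbed. *)
Lemma card_leXX : infinite_set A -> A `*` A #<= A.
Proof.
move=> Ainf; have [a0 _] := infinite_setN0 Ainf.
have /infiniteP/(card_le_fun a0)[e eA ei] := Ainf.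
have {}ei : injective e by move=> m n; apply: ei; rewrite inE.
pose G0 := [set (e x.1, e x.2, e (choice.pickle x)) | x in [set: nat * nat]].
have sqG0 : square_graph G0 by apply: square_graph_nat => // n; exact: eA.
(* The alternative [G = set0] covers the union of the empty chain, which does not contain [G0]. *)
pose P G := square_graph G /\ (G = set0 \/ G0 `<=` G).
have [|G [[sqG G0G] Gmax]] := @Zorn_bigcup _ P.
  move=> F FP Ftot; split; first by apply: square_graph_bigcup => // G /FP[].
  have [F0|/existsNP[G /not_implyP[FG nG0]]] :=
      pselect (forall G, F G -> G = set0).
    by left; rewrite -subset0 => x [G /F0 ->].
  right; have [_ [//|G0G]] := FP _ FG.
  by apply: subset_trans G0G _ => x Gx; exists G.
have {}G0G : G0 `<=` G.
  case: G0G => // G0E; exfalso; apply: (Gmax G0); last by split => //; right.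
  rewrite G0E; split; first exact: sub0set.
  move=> /(_ (e 0%N, e 0%N, e (choice.pickle (0%N, 0%N)))); apply.
  by exists (0%N, 0%N).
have Dinf : infinite_set (square_dom G).
  apply/infiniteP; apply: (@card_le_inj _ _ _ _ e) => [n _|m n _ _ /ei//].
  by exists (e (choice.pickle (n, n))); apply: G0G; exists (n, n).
have [AD|DA] := card_le_total (A `\` square_dom G) (square_dom G); last first.
  have [G' sqG' GG'] := square_graph_extend Dinf sqG DA.
  exfalso; apply: (Gmax G') => //; split => //; right.
  exact: subset_trans G0G (properW GG').
have [DA Gdom Gtot Ginj] := sqG.
have DD : square_dom G `*` square_dom G #<= square_dom G.
  apply: (@card_le_rel _ _ _ _ (fun p c => G (p, c))).
    move=> [a b] [/= Da Db]; have [c Gc] := Gtot a b Da Db; exists c => //.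
    by have [] := Gdom _ _ Gc.
  by move=> p p' c _ _; exact: Ginj.
have {}AD : A #<= square_dom G.
  by rewrite -(setDUK DA); apply: card_leU.
apply: card_le_trans (card_leX AD AD) _; apply: card_le_trans DD _.
exact: subset_card_le.
Qed.

End square.

(** An element of the union is coded by some [y] and a position in [s y]; since [Y] is infinite,
    such pairs embed in the square of [Y]. *)
Lemma card_bigcup_seq_le T (K : eqType) (Y : set T) (s : T -> seq K) :
  infinite_set Y -> \bigcup_(y in Y) [set` s y] #<= Y.
Proof.
move=> Yinf; apply: card_le_trans (card_leXX Yinf).
have YN : Y `*` [set: nat] #<= Y `*` Y.
  by apply: card_leX => //; exact/infiniteP.
apply: card_le_trans YN.
(* The default of [nth] varies with [k]; the bound on the position makes it irrelevant, so a code
   determines [k]. *)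
apply: (@card_le_rel _ _ _ _
  (fun k p => (p.2 < size (s p.1))%N /\ nth k (s p.1) p.2 = k)).
  move=> k [y Yy /= ky]; exists (y, index k (s y)) => //=.
  by rewrite nth_index ?index_mem.
move=> k k' [y n] _ _ /= [sn kE] [_ k'E].
by rewrite -kE -k'E; exact: set_nth_default.
Qed.

(** * Cardinality of finite codes over an infinite set *)

Section code_cardinal.
Variable K : Type.
Hypothesis Kinf : infinite_set [set: K].

Lemma card_le_countType (T : countType) : [set: T] #<= [set: K].
Proof.
move: Kinf => /infiniteP; apply: card_le_trans.
by apply: (@card_le_inj _ _ _ _ (@choice.pickle T)).
Qed.

Lemma card_le_prod T U : [set: T] #<= [set: K] -> [set: U] #<= [set: K] ->
  [set: T * U] #<= [set: K].
Proof.
move=> TK UK; rewrite -setXTT; apply: card_le_trans (card_leXX Kinf).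
exact: card_leX.
Qed.

(** A list is folded into one element of [K] by an injection of pairs. The start value [k0] may
    itself be the code of a pair, so the length is recorded as well. *)
Lemma card_le_seq T : [set: T] #<= [set: K] -> [set: seq T] #<= [set: K].
Proof.
move=> TK; have [k0 _] := infinite_setN0 Kinf.
have [f _ fi] := card_le_fun k0 TK.
have KK : [set: K * K] #<= [set: K] by apply: card_le_prod.
have [h _ hi] := card_le_fun k0 KK.
pose enc := foldr (fun x k => h (f x, k)) k0.
have NK : [set: nat * K] #<= [set: K].
  by apply: card_le_prod => //; exact: card_le_countType.
apply: card_le_trans NK.
apply: (@card_le_inj _ _ _ _ (fun s => (size s, enc s))) => //.
elim=> [|x s ih] [|y r] //= _ _ [sr].
move=> /(hi _ _ (in_setT _) (in_setT _))[].
move=> /(fi _ _ (in_setT _) (in_setT _)) -> e.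
by congr cons; apply: ih; rewrite ?in_setT ?sr ?e.
Qed.

End code_cardinal.

(** * Finitely supported functions in L_1 *)

Section L1_class.
Context d (T : measurableType d) (R : realType).
Variable mu : {measure set T -> \bar R}.
Implicit Types f g h : T -> R.
Local Notation L1 := (LspaceType1 mu).
Local Notation integ f := (mu.-integrable setT (EFin \o f)).

(* The class of h in L_1, with junk value 0 when h is not integrable. *)
Definition L1_class h : L1 :=
  if pselect (h \in Lfun mu 1) is left hL then Lspace_pi (Lfun_Sub (lexx _) hL)
  else 0.

Lemma L1_classE (F : LfunType mu (@lexx _ _ 1%E)) : L1_class F = Lspace_pi F.
Proof.
rewrite /L1_class; case: pselect => [FL|]; last by have := LfunP F.
by congr Lspace_pi; exact: val_inj.
Qed.

Lemma L1_classP h : integ h -> exists2 F : LfunType mu (@lexx _ _ 1%E),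
  h = F & L1_class h = Lspace_pi F.
Proof.
move=> /Lfun1_integrable hL; exists (Lfun_Sub (lexx _) hL) => //.
exact: (L1_classE (Lfun_Sub (lexx _) hL)).
Qed.

Lemma L1_class_norm h : integ h -> `|L1_class h| = \int[mu]_x `|h x|.
Proof.
move=> /L1_classP[F -> ->]; rewrite /Num.norm /=.
by rewrite Lspace_normE Lnorm1.
Qed.

Lemma L1_class_repr (u : L1) : L1_class (Lspace_repr u) = u.
Proof. by rewrite L1_classE Lspace_reprK. Qed.

Lemma L1_repr_integrable (u : L1) : integ (Lspace_repr u).
Proof. by apply/Lfun1_integrable; exact: LfunP. Qed.

Lemma integrable_EFinD f g : integ f -> integ g -> integ (f \+ g).
Proof. by move=> fi gi; exact: (integrableD measurableT fi gi). Qed.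

Lemma integrable_EFinZ a f : integ f -> integ (a \*: f).
Proof. by move=> fi; exact: (integrableZl measurableT a fi). Qed.

Lemma L1_classD f g : integ f -> integ g ->
  L1_class (f \+ g) = L1_class f + L1_class g.
Proof.
move=> /L1_classP[F -> ->] /L1_classP[G -> ->].
by rewrite -Lspace_piD -L1_classE.
Qed.

Lemma L1_classZ a f : integ f -> L1_class (a \*: f) = a *: L1_class f.
Proof.
move=> /L1_classP[F -> ->].
have -> : a *: Lspace_pi F = Lspace_pi (a *: F) by exact: Lspace_scaleE.
by rewrite -L1_classE.
Qed.

Lemma L1_classB f g : integ f -> integ g ->
  L1_class f - L1_class g = L1_class (f \- g).
Proof.
move=> fi gi; apply/eqP; rewrite subr_eq -L1_classD//; last first.
  exact: (integrableB measurableT fi gi).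
by apply/eqP; congr L1_class; apply/funext => x /=; rewrite subrK.
Qed.

End L1_class.

Lemma normB_add (R : numDomainType) (V : normedZmodType R) (u v w z : V) :
  `|u + v - (w + z)| <= `|u - w| + `|v - z|.
Proof. by rewrite opprD addrACA ler_normD. Qed.

Lemma normB_scale (R : numFieldType) (V : normedModType R) (a b : R) (u w : V) :
  `|a *: u - b *: w| <= `|a| * `|u - w| + `|a - b| * `|w|.
Proof.
have -> : a *: u - b *: w = a *: (u - w) + (a - b) *: w.
  by rewrite scalerBr scalerBl addrA subrK.
by rewrite (le_trans (ler_normD _ _))// !normrZ.
Qed.

Lemma indic_setD (T : Type) (R : pzRingType) (B C : set T) : C `<=` B ->
  \1_(B `\` C) = \1_B \- \1_C :> (T -> R).
Proof.
move=> CB; apply/funext => x /=; rewrite !indicE in_setD.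
have [xC|xC] := boolP (x \in C); last by rewrite andbT subr0.
by rewrite mem_set ?subrr//; apply: CB; exact: set_mem.
Qed.

(** * Density of rational step functions in L_1 of the cube *)

Section cell.
Variables (R : realType) (K : choiceType).
Local Notation cube := (measurable_cube K).
Local Notation mu := (@coin R K).
Local Notation integ f := (mu.-integrable setT (EFin \o f)).
Implicit Types (p : seq (K * bool)) (l : seq (rat * seq (K * bool))).

(** Fixes the bits listed in [p]. With distinct coordinates the measure is [2^-n], where [n] is the
    length of [p]; contradictory entries give the empty set. *)
Definition cell p : set cube := [set x | all (fun ib => x ib.1 == ib.2) p].

(** Rational coefficients and finite lists keep the codes [l] within the cardinality of an infinite
    [K]. *)
Definition step l (x : cube) : R := \sum_(t <- l) ratr t.1 * \1_(cell t.2) x.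

Lemma cell_supported p : supported (map fst p) (cell p : set (Defs.cube K)).
Proof.
move=> x y xy; congr is_true; apply: eq_in_all => ib ibp.
by rewrite xy// map_f.
Qed.

Lemma cylinder_measurable (A : set (Defs.cube K)) : cylinder A ->
  measurable (A : set cube).
Proof. exact: sub_sigma_algebra. Qed.

Lemma measurable_cell p : measurable (cell p).
Proof.
by apply: cylinder_measurable; exists (map fst p); exact: cell_supported.
Qed.

Lemma cell_cons i b p (x : cube) :
  \1_(cell ((i, b) :: p)) x = (x i == b)%:R * \1_(cell p) x :> R.
Proof.
rewrite !indicE -natrM mulnb; congr (nat_of_bool _)%:R.
by apply/idP/andP; rewrite !inE /= => /andP.
Qed.

Lemma step_cons t l : step (t :: l) = (ratr t.1 \*: \1_(cell t.2)) \+ step l.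
Proof. by apply/funext => x; rewrite /step big_cons. Qed.

Lemma integrable_coin_indic (A : set cube) : measurable A ->
  integ (\1_A : cube -> R).
Proof. exact: integrable_indic. Qed.

Lemma step_integrable l : integ (step l).
Proof.
elim: l => [|t l ih].
  rewrite (_ : step [::] = cst 0); last first.
    by apply/funext => x; rewrite /step big_nil.
  exact: (@finite_measure_integrable_cst _ _ _ mu _ 0 measurableT).
rewrite step_cons; apply: integrable_EFinD => //; apply: integrable_EFinZ.
by apply: integrable_coin_indic; exact: measurable_cell.
Qed.

Lemma step_supported l :
  supported (flatten [seq map fst t.2 | t <- l]) (step l : Defs.cube K -> R).
Proof.
move=> x y xy; apply: eq_big_seq => t tl; congr (_ * _).
apply: (@supported_indic R K _ _ (@cell_supported t.2)) => i ip; apply: xy.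
by apply/flattenP; exists (map fst t.2) => //; exact: map_f.
Qed.

Lemma step_cat l l' : step (l ++ l') = step l \+ step l'.
Proof. by apply/funext => x; rewrite /step big_cat. Qed.

Lemma step_scale q l : step [seq (q * t.1, t.2) | t <- l] = ratr q \*: step l.
Proof.
apply/funext => x; rewrite -[RHS]/(ratr q * step l x) /step big_map mulr_sumr.
by apply: eq_bigr => t _; rewrite /= rmorphM mulrA.
Qed.

Lemma step_restrict i b l (x : cube) :
  step [seq (t.1, (i, b) :: t.2) | t <- l] x = (x i == b)%:R * step l x.
Proof.
rewrite /step big_map mulr_sumr.
by apply: eq_bigr => t _; rewrite /= cell_cons mulrCA.
Qed.

(** Induction on the support: [g] is split along [x i], and fixing that bit with [upd] leaves a
    function supported on the remaining coordinates. *)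
Lemma supported_step (s : seq K) (g : Defs.cube K -> rat) : supported s g ->
  exists l, forall x, step l x = ratr (g x).
Proof.
elim: s g => [|i s ih] g gs.
  exists [:: (g point, [::])] => x; rewrite /step big_seq1 /= indicE mem_set//.
  by rewrite mulr1 (gs x point).
have gb b : supported s (fun x => g (upd x i b)).
  move=> x y xy; apply: gs => j; rewrite inE /upd.
  by case: eqP => //= _; exact: xy.
have [l lE] := ih _ (gb true); have [l' l'E] := ih _ (gb false).
exists ([seq (t.1, (i, true) :: t.2) | t <- l] ++
   [seq (t.1, (i, false) :: t.2) | t <- l']) => x.
rewrite step_cat /= !step_restrict lE l'E.
have updE : upd x i (x i) = x.
  by apply/funext => j; rewrite /upd; case: eqP => // ->.
by case xi : (x i) updE => /= ->; rewrite mul1r mul0r ?addr0 ?add0r.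
Qed.

Lemma cylinder_step (A : set (Defs.cube K)) : cylinder A ->
  exists l, step l = \1_A.
Proof.
move=> [s As].
have As' : supported s (fun x => (x \in A)%:R : rat).
  move=> x y xy; congr (nat_of_bool _)%:R.
  by apply/idP/idP; rewrite !inE (As _ _ xy).
have [l lE] := supported_step As'; exists l; apply/funext => x.
by rewrite lE ratr_nat indicE.
Qed.

(** Membership in the norm closure of the step functions; the lemmas below make it a closed linear
    subspace, and finally the whole space. *)
Definition step_approx (u : L1_cube R K) :=
  forall e, 0 < e -> exists l, `|u - L1_class mu (step l)| < e.

Lemma step_approx_step l : step_approx (L1_class mu (step l)).
Proof. by move=> e e0; exists l; rewrite subrr normr0. Qed.

Lemma step_approxD u v : step_approx u -> step_approx v -> step_approx (u + v).
Proof.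
move=> ua va e e0; have e2 : 0 < e / 2 by rewrite divr_gt0.
have [l ul] := ua _ e2; have [l' vl] := va _ e2; exists (l ++ l').
rewrite step_cat (L1_classD (step_integrable l) (step_integrable l')).
by rewrite (le_lt_trans (normB_add _ _ _ _))// [e]splitr ltrD.
Qed.

(** The scalar is real but coefficients must be rational, so [a] is replaced by a nearby [q]. Half
    of [e] pays for approximating [u], half for [a - q]; the added ones keep the denominators
    positive. *)
Lemma step_approxZ a u : step_approx u -> step_approx (a *: u).
Proof.
move=> ua e e0; pose e1 := e / 2 / (`|a| + 1).
have a1 : 0 < `|a| + 1 by rewrite ltr_wpDl.
have [l ul] : exists l, `|u - L1_class mu (step l)| < e1.
  by apply: ua; rewrite !divr_gt0.
set w := L1_class _ _ in ul; have w1 : 0 < `|w| + 1 by rewrite ltr_wpDl.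
have e2 : 0 < e / 2 / (`|w| + 1) by rewrite !divr_gt0.
have [q] := rat_in_itvoo (ltr_pwDr e2 (lexx a)).
rewrite in_itv /= => /andP[aq qa]; exists [seq (q * t.1, t.2) | t <- l].
rewrite step_scale L1_classZ; last exact: step_integrable.
rewrite (le_lt_trans (normB_scale _ _ _ _))// [ltRHS]splitr ltr_leD//.
  apply: (@le_lt_trans _ _ ((`|a| + 1) * `|u - w|)).
    by rewrite ler_wpM2r// lerDl.
  by rewrite mulrC -ltr_pdivlMr.
apply: (@le_trans _ _ (`|a - ratr q| * (`|w| + 1))).
  by rewrite ler_wpM2l// lerDl.
rewrite -ler_pdivlMr// distrC ltW// gtr0_norm ?subr_gt0//.
by rewrite ltrBlDl.
Qed.

Lemma step_approxB u v : step_approx u -> step_approx v -> step_approx (u - v).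
Proof.
move=> ua va; rewrite -(scaleN1r v); apply: step_approxD => //.
exact: step_approxZ.
Qed.

Lemma step_approx_lim u :
  (forall e, 0 < e -> exists2 v, step_approx v & `|u - v| < e) -> step_approx u.
Proof.
move=> uv e e0; have e2 : 0 < e / 2 by rewrite divr_gt0.
have [v va vu] := uv _ e2; have [l vl] := va _ e2; exists l.
by rewrite (le_lt_trans (ler_distD v _ _))// [e]splitr ltrD.
Qed.

(** Dynkin's argument: cylinders are stable under intersection, and the sets with approximable
    indicator form a lambda-system, by linearity for differences and continuity of the measure for
    increasing unions. *)
Lemma step_approx_indic (A : set cube) : measurable A ->
  step_approx (L1_class mu \1_A).
Proof.
move=> mA; pose H := [set A : set cube | measurable A /\
  step_approx (L1_class mu \1_A)].
suff : <<s @measurable _ (Defs.cube K) >> `<=` H by move=> /(_ A mA)[].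
apply: lambda_system_subset => //.
- exact: measurableI.
- split => //.
  + have cT : cylinder [set: Defs.cube K] by exists [::].
    by split => //; have [l <-] := cylinder_step cT; exact: step_approx_step.
  + move=> B C CB [mB Ba] [mC Ca]; split; first exact: measurableD.
    rewrite indic_setD// -L1_classB; last 2 first.
      exact: integrable_coin_indic.
      exact: integrable_coin_indic.
    exact: step_approxB.
  + move=> F ndF HF; have mF n : measurable (F n : set cube) := (HF n).1.
    have mU : measurable (\bigcup_n F n : set cube) by exact: bigcup_measurable.
    split => //; apply: step_approx_lim => e e0.
    have muU : mu (\bigcup_n F n) \is a fin_num by exact: fin_num_measure.
    (* The L_1 distance between the indicators of the union and of [F N] is the measure of their
       difference, small for large [N] by continuity from below. *)
    have [N _] : \forall n \near \oo, (mu (\bigcup_n F n) - e%:E < mu (F n))%E.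
      have muUe : nbhs (mu (\bigcup_n F n))
          [set y | mu (\bigcup_n F n) - e%:E < y]%E.
        apply: open_nbhs_nbhs; split; first exact: open_ereal_gt_ereal.
        have : (mu (\bigcup_n F n) - e%:E < mu (\bigcup_n F n))%E.
          by rewrite lteBlDr// lteDl.
        by [].
      exact: (nondecreasing_cvg_mu (mu := mu) mF mU ndF muUe).
    move=> /(_ N (leqnn N)) muN.
    exists (L1_class mu \1_(F N)); first exact: (HF N).2.
    rewrite L1_classB; [|exact: integrable_coin_indic..].
    have FU : F N `<=` \bigcup_n F n by move=> x Fx; exists N.
    have mUF : measurable (\bigcup_n F n `\` F N : set cube).
      exact: measurableD.
    rewrite -indic_setD// L1_class_norm; last exact: integrable_coin_indic.
    rewrite (@eq_Rintegral _ _ _ _ _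
      (\1_(\bigcup_n F n `\` F N) : cube -> R)); last first.
      by move=> x _; rewrite ger0_norm.
    rewrite -lte_fin /Rintegral integral_indic// setIT fineK; last first.
      exact: fin_num_measure.
    suff : (mu (\bigcup_n F n `\` F N : set cube) < e%:E)%E by [].
    rewrite measureD// ?ltey_eq ?muU// setIidr//.
    by rewrite lteBlDr ?fin_num_measure// addeC -lteBlDr.
- move=> B cB; split; first exact: cylinder_measurable.
  by have [l <-] := cylinder_step cB; exact: step_approx_step.
Qed.

Lemma step_approx_sum I (r : seq I) (c : I -> R) (A : I -> set cube) :
  (forall i, measurable (A i)) ->
  let f := fun x : cube => \sum_(i <- r) c i * \1_(A i) x in
  integ f /\ step_approx (L1_class mu f).
Proof.
move=> mA; elim: r => [|i r [fi fa]] /=.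
  under eq_fun do rewrite big_nil.
  rewrite (_ : (fun=> 0) = step [::]); last first.
    by apply/funext => x; rewrite /step big_nil.
  by split; [exact: step_integrable|exact: step_approx_step].
under eq_fun do rewrite big_cons.
have ii := integrable_coin_indic (mA i).
have cii := integrable_EFinZ (c i) ii.
split; first exact: (integrable_EFinD cii fi).
rewrite (L1_classD cii fi); apply: step_approxD => //.
by rewrite (L1_classZ _ ii); apply/step_approxZ/step_approx_indic.
Qed.

Lemma step_approx_sfun (g : {sfun cube >-> R}) : step_approx (L1_class mu g).
Proof.
pose s := fset_set (range g).
rewrite (_ : (g : cube -> R) =
  (fun x => \sum_(i < #|` s|) s`_i * \1_(g @^-1` [set s`_i]) x)).
  by apply: (step_approx_sum _ _ _).2 => i; exact: measurable_sfunP.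
by apply/funext => x; exact: fimfunEord.
Qed.

(** Simple functions are finite combinations of indicators, and they approximate every integrable
    function. *)
Lemma step_dense u : step_approx u.
Proof.
have ui := L1_repr_integrable u.
have [g [gi _ ug]] := approximation_sfun_integrable measurableT ui.
apply: step_approx_lim => e e0.
have [N _ /(_ N (leqnn N))] : \forall n \near \oo,
    (\int[mu]_z `|(Lspace_repr u z)%:E - (g n z)%:E| < e%:E)%E.
  apply: (ug [set y | y < e%:E]%E); apply: open_nbhs_nbhs.
  by split; [exact: open_ereal_lt_ereal|rewrite /mkset lte_fin].
move=> ugN; exists (L1_class mu (g N)); first exact: step_approx_sfun.
rewrite -[u]L1_class_repr (L1_classB ui (gi N)).
rewrite L1_class_norm; last exact: (integrableB measurableT ui (gi N)).
rewrite -lte_fin /Rintegral fineK// ge0_fin_numE; last exact: integral_ge0.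
by rewrite (lt_trans ugN) ?ltry.
Qed.

End cell.

(** * Free coordinates *)

Section flip.
Variables (R : realType) (K : choiceType).
Local Notation cube := (measurable_cube K).
Local Notation mu := (@coin R K).
Local Notation integ f := (mu.-integrable setT (EFin \o f)).

(** Invariance under [flip i] is the form in which independence of coordinate [i] is used below. *)
Definition flip (i : K) (x : cube) : cube := upd x i (~~ x i).

Lemma flip_supported (U : Type) (s : seq K) i (f : Defs.cube K -> U) :
  supported s f -> supported (i :: s) (f \o flip i).
Proof.
move=> fs x y xy; apply: fs => j js; rewrite /flip /upd.
by case: eqP => _; rewrite xy// inE ?eqxx// js orbT.
Qed.

Lemma cylinder_flip i (A : set (Defs.cube K)) :
  cylinder A -> cylinder (flip i @^-1` A).
Proof. by move=> [s As]; exists (i :: s); exact: flip_supported. Qed.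

Lemma measurable_flip i : measurable_fun setT (flip i).
Proof.
apply: (@measurability _ _ cube cube setT _
  (@measurable _ (Defs.cube K))) => //.
move=> _ [A cA <-]; rewrite setTI; apply: cylinder_measurable.
exact: cylinder_flip.
Qed.

Lemma avg_flip i (f : Defs.cube K -> R) : avg i (f \o flip i) = avg i f.
Proof.
have flipE x b : flip i (upd x i b) = upd x i (~~ b).
  by apply/funext => j; rewrite /flip /upd eqxx; case: eqP.
by apply/funext => x; rewrite /avg /= !flipE addrC.
Qed.

(** By uniqueness of the extension it suffices to compare the two measures on cylinders. *)
Lemma coin_flip i (A : set cube) : measurable A -> mu (flip i @^-1` A) = mu A.
Proof.
move=> mA; have mflip := measurable_flip i.
apply/esym; apply: (@measure_extension_unique _ _ _ (@cylinder_measure R K) _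
   (measure_function_pushforward__canonical__measure_function_Measure
     mu mflip)) => //.
- exists (fun=> setT); first by rewrite bigcup_const//; exists 0%N.
  move=> n; split => //; suff : (@cylinder_measure R K setT < +oo)%E by [].
  by rewrite cylinder_measureT ltry.
move=> B cB; rewrite /= /pushforward coin_cylinder; last exact: cylinder_flip.
have [s Bs] := cB.
(* With [i] at the head of the support, [mean] begins with [avg i], which does not see the flip. *)
have Bs' : supported (i :: s) B.
  by apply: supportedW Bs => j js; rewrite inE js orbT.
rewrite (cylinder_measureE _ Bs').
rewrite (cylinder_measureE _ (@flip_supported _ s i B Bs)) /=.
by rewrite -(avg_flip i \1_B).
Qed.

Lemma integral_flip i (f : cube -> \bar R) : measurable_fun [set: cube] f ->
  (forall x, 0 <= f x)%E -> (\int[mu]_x f (flip i x) = \int[mu]_x f x)%E.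
Proof.
move=> mf f0; have mflip := measurable_flip i.
rewrite -(ge0_integral_pushforward mflip mu measurableT mf); last first.
  by move=> y _; exact: f0.
by apply: eq_measure_integral => A mA _; rewrite -[RHS](coin_flip i).
Qed.

(** The flip exchanges the halves [x i = true] and [x i = false] and preserves [f], so both carry
    the same integral. *)
Lemma Rintegral_half i b (f : cube -> R) : integ f -> f \o flip i = f ->
  \int[mu]_x `|(x i == b)%:R * f x| = 2^-1 * \int[mu]_x `|f x|.
Proof.
move=> fi ff.
have mf : measurable_fun [set: cube] f.
  by apply/measurable_EFinP; exact: measurable_int fi.
pose A (c : bool) : set cube := [set x | x i == c].
have mA c : measurable (A c).
  apply: cylinder_measurable; exists [:: i] => x y xy.
  by rewrite /A /mkset xy ?inE.
have AE c (x : cube) : (x i == c)%:R = \1_(A c) x :> R.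
  by rewrite indicE; congr (nat_of_bool _)%:R; apply/idP/idP; rewrite inE.
pose g c (x : cube) := `|(x i == c)%:R * f x|.
have gi c : integ (g c).
  apply: (@le_integrable _ _ _ mu _ measurableT _ (EFin \o f)) => //.
    apply/measurable_EFinP; apply: measurableT_comp => //.
    apply: measurable_funM => //; rewrite /g; under eq_fun do rewrite AE.
    exact: measurable_indic.
  move=> x _; rewrite /= lee_fin /g normr_id normrM; case: eqP => _.
    by rewrite normr1 mul1r.
  by rewrite normr0 mul0r.
have gflip : \int[mu]_x g b x = \int[mu]_x g (~~ b) x.
  congr fine; rewrite -(@integral_flip i).
  - apply: eq_integral => x _; rewrite /g; have -> : f (flip i x) = f x.
      by rewrite -[RHS](congr1 (fun h => h x) ff).
    rewrite /flip /upd eqxx; congr (`|_ * _|%:E); congr (nat_of_bool _)%:R.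
    by case: b; case: (x i).
  - exact: measurable_int (gi _).
  - by move=> x; rewrite lee_fin; exact: normr_ge0.
have -> : \int[mu]_x `|f x| = \int[mu]_x (g b x + g (~~ b) x).
  apply: eq_Rintegral => x _.
  rewrite /g; case: b gflip; case: (x i) => _ /=;
    by rewrite mul1r mul0r normr0 ?addr0 ?add0r.
rewrite RintegralD// -gflip; have half (a : R) : a = 2^-1 * (a + a) by field.
exact: half.
Qed.

End flip.

(** For finite [Y] the union is finite. For infinite [Y], a finite complement [r] could be appended
    to every list; the lists would then cover [K], which would embed in [Y] and hence in [J]. *)
Lemma infinite_complement_bigcup_seq T J (K : choiceType) (Y : set T)
    (s : T -> seq K) :
  infinite_set [set: K] -> Y #<= [set: J] -> ~ ([set: K] #<= [set: J]) ->
  infinite_set (~` \bigcup_(y in Y) [set` s y]).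
Proof.
move=> Kinf YJ nKJ /finite_seqP[r rE].
have [Yfin|Yinf] := pselect (finite_set Y).
  apply: Kinf; rewrite -(setUv (\bigcup_(y in Y) [set` s y])) rE.
  by rewrite finite_setU; split=> //; apply: bigcup_finite.
apply: nKJ; apply: card_le_trans YJ.
apply: card_le_trans (card_bigcup_seq_le (fun y => s y ++ r) Yinf).
apply: subset_card_le => k _.
have [[y Yy ky]|nk] := pselect ((\bigcup_(y in Y) [set` s y]) k).
  by exists y => //=; rewrite mem_cat (ky : k \in s y).
have [y Yy] := infinite_setN0 Yinf; exists y => //=.
have : [set` r] k by rewrite -rE.
by move=> /= kr; rewrite mem_cat kr orbT.
Qed.

(** * Restriction and rescaling on cells of free coordinates *)

Section cell_integral.
Variables (R : realType) (K : choiceType).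
Local Notation cube := (measurable_cube K).
Local Notation mu := (@coin R K).
Local Notation integ f := (mu.-integrable setT (EFin \o f)).
Implicit Types (p : seq (K * bool)).

Lemma supported_flip (U : Type) (s : seq K) i (f : Defs.cube K -> U) :
  supported s f -> i \notin s -> f \o flip i = f.
Proof.
move=> fs si; apply/funext => x; apply: fs => j js; rewrite /flip /upd.
by case: eqP => // ji; rewrite -ji js in si.
Qed.

Lemma integrable_cellM p (g : cube -> R) : integ g -> integ (\1_(cell p) \* g).
Proof.
move=> gi; have mg : measurable_fun [set: cube] g.
  by apply/measurable_EFinP; exact: measurable_int gi.
apply: (@le_integrable _ _ _ mu _ measurableT _ (EFin \o g)) => //.
  apply/measurable_EFinP; apply: measurable_funM => //.
  by apply: measurable_indic; exact: measurable_cell.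
move=> x _; rewrite /= lee_fin normrM ger0_norm//.
by rewrite ler_piMl// indicE lern1 leq_b1.
Qed.

(** Each new coordinate halves the integral, because neither the smaller cell nor [g] depends on
    it. *)
Lemma Rintegral_cellM p (g : cube -> R) : integ g -> uniq (map fst p) ->
  (forall i, i \in map fst p -> g \o flip i = g) ->
  \int[mu]_x `|\1_(cell p) x * g x| = 2^-1 ^+ size p * \int[mu]_x `|g x|.
Proof.
move=> gi; elim: p => [|[i b] p ih] /=.
  move=> _ _; rewrite mul1r; apply: eq_Rintegral => x _.
  by rewrite indicE mem_set// mul1r.
move=> /andP[ip up] pg; have {ih}ih : \int[mu]_x `|\1_(cell p) x * g x| =
    2^-1 ^+ size p * \int[mu]_x `|g x|.
  by apply: ih => // j jp; apply: pg; rewrite inE jp orbT.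
rewrite exprS -mulrA -ih -(@Rintegral_half _ _ i b (\1_(cell p) \* g)).
- by apply: eq_Rintegral => x _; rewrite cell_cons mulrA.
- exact: integrable_cellM.
- have gE : g \o flip i = g by apply: pg; rewrite inE eqxx.
  have pE := supported_flip (@supported_indic R K _ _ (@cell_supported K p)) ip.
  by apply/funext => x; rewrite /= -[in RHS]gE -[in RHS]pE.
Qed.

Lemma L1_class_halve i b p (g : cube -> R) : integ g ->
  L1_class mu (2 ^+ size p \*: (\1_(cell p) \* g)) =
  2^-1 *: (L1_class mu (2 ^+ (size p).+1 \*: (\1_(cell ((i, b) :: p)) \* g)) +
           L1_class mu
             (2 ^+ (size p).+1 \*: (\1_(cell ((i, ~~ b) :: p)) \* g))).
Proof.
move=> gi; rewrite -L1_classD; [|exact/integrable_EFinZ/integrable_cellM..].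
rewrite -L1_classZ; last first.
  by apply: integrable_EFinD; exact/integrable_EFinZ/integrable_cellM.
congr L1_class; apply/funext => x.
change (2 ^+ size p * (\1_(cell p) x * g x) =
  2^-1 * (2 ^+ (size p).+1 * (\1_(cell ((i, b) :: p)) x * g x) +
          2 ^+ (size p).+1 * (\1_(cell ((i, ~~ b) :: p)) x * g x)) :> R).
rewrite !cell_cons exprS.
by case: b; case: (x i) => /=; field.
Qed.

(** The bits are chosen one at a time: by [L1_class_halve] the current vector is the average of two
    candidates, so [f] exceeds [c] on at least one of them. *)
Lemma cell_slice (f : {scalar L1_cube R K}) (c : R) (t : seq K)
    (g : cube -> R) :
  integ g -> c < f (L1_class mu g) ->
  exists2 p, map fst p = t &
    c < f (L1_class mu (2 ^+ size p \*: (\1_(cell p) \* g))).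
Proof.
move=> gi cg; elim: t => [|i t [p pt cp]].
  exists [::] => //; rewrite (_ : _ \*: _ = g)//; apply/funext => x.
  change (1 * (\1_(cell [::]) x * g x) = g x).
  by rewrite indicE mem_set// !mul1r.
move: cp; rewrite (L1_class_halve i true p gi) linearZ linearD /=.
set a := f _; set b := f _; move=> cab.
have [ca|ac] := ltP c a; first by exists ((i, true) :: p); rewrite /= ?pt.
by exists ((i, false) :: p); rewrite /= ?pt// -/b; lra.
Qed.

Lemma cell_norm p (w : cube -> R) : integ w -> uniq (map fst p) ->
  (forall i, i \in map fst p -> w \o flip i = w) ->
  `|L1_class mu (2 ^+ size p \*: (\1_(cell p) \* w))| = `|L1_class mu w|.
Proof.
move=> wi up pw; have pwi := integrable_cellM p wi.
rewrite (L1_classZ _ pwi) normrZ (L1_class_norm pwi) (L1_class_norm wi).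
rewrite (Rintegral_cellM wi up pw) ger0_norm ?exprn_ge0// mulrA -exprMn.
by rewrite divff// expr1n mul1r.
Qed.

(* On the cell, of measure 2^-n, the norm of [g] has been scaled down by 2^-n,
   while the second summand is supported there. *)
Lemma cell_norm_add p (w g : cube -> R) : integ w -> integ g ->
  uniq (map fst p) -> (forall i, i \in map fst p -> w \o flip i = w) ->
  (forall i, i \in map fst p -> g \o flip i = g) ->
  `|L1_class mu g| + `|L1_class mu w| -
    2 * (2^-1 ^+ size p * `|L1_class mu g|) <=
  `|L1_class mu g + L1_class mu (2 ^+ size p \*: (\1_(cell p) \* w))|.
Proof.
move=> wi gi up pw pg; set W := 2 ^+ size p \*: _.
have Wi : integ W by exact/integrable_EFinZ/integrable_cellM.
rewrite -(cell_norm wi up pw) -(L1_classD gi Wi).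
have gWi := integrable_EFinD gi Wi; have pgi := integrable_cellM p gi.
rewrite !L1_class_norm// -(Rintegral_cellM gi up pg).
have Ngi := integrable_norm gi; have NWi := integrable_norm Wi.
have Npgi := integrable_norm pgi.
have NgWi := integrable_EFinD Ngi NWi; have N2i := integrable_EFinZ 2 Npgi.
rewrite -(RintegralD measurableT Ngi NWi) -(RintegralZl _ measurableT Npgi).
rewrite -(RintegralB measurableT NgWi N2i); apply: le_Rintegral => //.
- exact: (integrableB measurableT NgWi N2i).
- exact: integrable_norm gWi.
move=> x _.
change (`|g x| + `|2 ^+ size p * (\1_(cell p) x * w x)| -
  2 * `|\1_(cell p) x * g x| <=
  `|g x + 2 ^+ size p * (\1_(cell p) x * w x)|).
(* Off the cell both sides equal [|g x|]; on it the claim reduces to [|b| - |a| <= |a + b|]. *)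
rewrite indicE; case: (x \in _); last first.
  by rewrite !mul0r !mulr0 normr0 addr0 mulr0 subr0 addr0.
rewrite !mul1r; set a := g x; set b := 2 ^+ _ * _.
have := ler_normB (a + b) a; rewrite addrAC subrr add0r.
lra.
Qed.

(** The code [(1, [::])] gives the constant function 1, a unit vector because the measure is a
    probability. *)
Lemma L1_class_1 : `|L1_class mu (step R [:: (1, [::])])| = 1.
Proof.
rewrite (L1_class_norm (@step_integrable R K _)).
rewrite (@eq_Rintegral _ _ _ _ _ (cst 1)); last first.
  move=> x _; rewrite /step big_seq1 /= indicE mem_set// rmorph1 mul1r.
  by rewrite normr1.
rewrite Rintegral_cst// mul1r -[RHS]/(fine 1%E); congr fine.
exact: coin_setT.
Qed.

End cell_integral.

(** Pulling [x] towards 0 by the factor [1 - d] leaves room for a ball of radius [d] inside both the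
    unit ball and the open half-space. *)
Lemma slice_shrink (R : realType) (X : normedModType R) (f : {scalar X})
    (c : R) x :
  continuous (f : X -> R) -> `|x| <= 1 -> c < f x ->
  exists x' d, 0 < d /\ forall z, `|x' - z| < d -> `|z| <= 1 /\ c < f z.
Proof.
move=> fc x1 cx.
have /nbhs_ballP[r /= r0 rf] : nbhs x [set z | c < f z].
  by have := fc x [set y | c < y]; apply; exact: lt_nbhsr.
(* The shrinking moves [x] by at most [d] and [z] lies within another [d], so [2 * d <= r] is
   enough. *)
pose d := Num.min (r / 2) 1.
have d0 : 0 < d by rewrite lt_min divr_gt0 ?ltr01.
have d1 : d <= 1 by rewrite ge_min lexx orbT.
have dr : d <= r / 2 by rewrite ge_min lexx.
exists ((1 - d) *: x), d; split=> // z xz.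
have x'1 : `|(1 - d) *: x| <= 1 - d.
  by rewrite normrZ ger0_norm ?subr_ge0// ler_piMr// subr_ge0.
have xx' : `|x - (1 - d) *: x| <= d.
  rewrite scalerBl scale1r opprB addrCA subrr addr0 normrZ gtr0_norm//.
  by rewrite ler_piMr// ltW.
split.
  rewrite -[z](subKr ((1 - d) *: x)) (le_trans (ler_normB _ _))//.
  by have := lerD x'1 (ltW xz); rewrite subrK.
apply: rf; rewrite -ball_normE /=.
rewrite (le_lt_trans (ler_distD ((1 - d) *: x) _ _))//.
by rewrite (lt_le_trans (ler_ltD xx' xz))//; lra.
Qed.

Lemma slice_nonempty (R : realType) (X : normedModType R) (f : {scalar X})
    (a : R) :
  0 < a -> exists2 x, `|x| <= 1 & sup (f @` unit_ball (X := X)) - a < f x.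
Proof.
move=> a0; have [fs|nfs] := pselect (has_sup (f @` unit_ball (X := X))).
  by have [_ [x x1 <-] fx] := sup_adherent a0 fs; exists x.
(* Without a supremum [sup] takes the default value 0, and the origin satisfies [- a < 0]. *)
by exists 0; rewrite ?normr0// sup_out// linear0 sub0r oppr_lt0.
Qed.

(** * The Daugavet property *)

Lemma normD_swap (R : numDomainType) (V : normedZmodType R) (g y w : V) :
  `|g + w| <= `|y - g| + `|y + w|.
Proof.
have -> : g + w = (g - y) + (y + w) by rewrite addrA subrK.
by rewrite distrC ler_normD.
Qed.

(** Normalising moves [w] by [|1 - |w||], at most [1 - |x| + d] because the norms of [w] and [x]
    differ by less than [d]. *)
Lemma normalize_dist (R : realFieldType) (V : normedModType R) (w x : V)
    (d : R) :
  w != 0 -> `|x| <= 1 -> `|- x - w| < d ->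
  `| `|w|^-1 *: w + x| < 1 - `|x| + 2 * d.
Proof.
move=> w0 x1; rewrite -opprD normrN addrC => wx.
have -> : `|w|^-1 *: w + x = (`|w|^-1 *: w - w) + (w + x).
  by rewrite addrA subrK.
rewrite (le_lt_trans (ler_normD _ _))//.
have -> : `| `|w|^-1 *: w - w| = `|1 - `|w| |.
  rewrite -[X in _ - X]scale1r -scalerBl normrZ -[X in _ * X]normr_id -normrM.
  by rewrite mulrBl mul1r mulVf ?normr_eq0.
have := lerB_normD w x; have := lerB_normD x w; rewrite (addrC x) => xw wx'.
suff : `|1 - `|w| | <= 1 - `|x| + d by lra.
by rewrite ler_norml; apply/andP; split; lra.
Qed.

Section main.
Variables (R : realType) (K : choiceType).
Local Notation cube := (measurable_cube K).
Local Notation mu := (@coin R K).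
Local Notation L1 := (L1_cube R K).
Local Notation integ f := (mu.-integrable setT (EFin \o f)).

(** A step function is found in the slice by density, then normalised. The factor [a] stays outside
    the code because it need not be rational. *)
Lemma slice_unit_step (f : {scalar L1}) (c : R) (x : L1) :
  continuous (f : L1 -> R) -> `|x| <= 1 -> c < f x ->
  exists a l, `|L1_class mu (a \*: @step R K l)| = 1 /\
    c < f (L1_class mu (a \*: step R l)).
Proof.
move=> fc x1 cx; have [x' [d [d0 x'd]]] := slice_shrink fc x1 cx.
have [l /x'd[ul fl]] := step_dense x' d0.
(* For negative [c] normalising could decrease [f] below [c]; one of the constants 1 and -1 has
   [f >= 0 > c] instead. For [c >= 0], dividing by a norm at most 1 only increases [f]. *)
have [c0|c0] := ltP c 0.
  set l1 := [:: (1, [::])] : seq (rat * seq (K * bool)).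
  have l1i := @step_integrable R K l1.
  have fE a :
      f (L1_class mu (a \*: step R l1)) = a * f (L1_class mu (step R l1)).
    by rewrite (L1_classZ _ l1i) linearZ.
  have NE a : `|L1_class mu (a \*: step R l1)| = `|a|.
    by rewrite (L1_classZ _ l1i) normrZ L1_class_1 mulr1.
  have [f1|f1] := leP 0 (f (L1_class mu (step R l1))).
    by exists 1, l1; rewrite NE fE normr1 mul1r (lt_le_trans c0).
  exists (-1), l1; rewrite NE fE normrN1 mulN1r; split => //.
  by rewrite (lt_trans c0)// oppr_gt0.
have li := @step_integrable R K l.
have u0 : 0 < `|L1_class mu (@step R K l)|.
  rewrite normr_gt0; apply/eqP => u0; move: fl; rewrite u0 linear0.
  by rewrite ltNge c0.
exists `|L1_class mu (@step R K l)|^-1, l; rewrite (L1_classZ _ li) normrZ.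
rewrite linearZ /= normfV normr_id mulVf ?gt_eqF//; split => //.
apply: (lt_le_trans fl); rewrite ler_peMl ?(le_trans c0 (ltW fl))//.
by rewrite invf_ge1.
Qed.

Lemma L1_daugavet_property (J : Type) : infinite_set [set: K] ->
  ~ ([set: K] #<= [set: J]) -> daugavet_property L1 J.
Proof.
move=> Kinf nKJ Y Y1 YJ S [f [a [fc a0 ->]]] e e0.
have [x x1 cx] := slice_nonempty f a0.
have [b [l [w1 fw]]] := slice_unit_step fc x1 cx.
set c := sup _ - a in cx fw *; set w := b \*: step R l in w1 fw.
have wi : integ w by exact/integrable_EFinZ/step_integrable.
pose supp (m : seq (rat * seq (K * bool))) :=
  flatten [seq map fst t.2 | t <- m].
(* Error budget: replacing [y] by its approximation [G] costs at most [2 * d <= e / 4]; the overlap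
   costs [2 * 2^-n * |G| <= e / 4], as [2^-n <= e / 16] and [|G| <= 1 + d <= 2]. *)
pose d := Num.min (e / 8) 1.
have d0 : 0 < d by rewrite lt_min divr_gt0 ?ltr01.
have d1 : d <= 1 by rewrite ge_min lexx orbT.
have de : d <= e / 8 by rewrite ge_min lexx.
have /choice[m ym] : forall y : L1, exists m, `|y - L1_class mu (step R m)| < d.
  by move=> y; exact: step_dense.
have [n ne] : exists n, 2^-1 ^+ n <= e / 16.
  exists (Num.bound (16 / e)); rewrite exprVn -[leRHS]invrK.
  rewrite lef_pV2 ?posrE ?exprn_gt0//.
    by rewrite invf_div ltW// upper_nthrootP.
  by rewrite invr_gt0 divr_gt0.
have fresh := infinite_complement_bigcup_seq (s := supp \o m) Kinf YJ nKJ.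
(* The support of [w] is avoided too, so that restricting [w] to a cell and rescaling preserves its
   norm. *)
have := infinite_setD fresh (finite_seq (supp l)).
move=> /(infinite_set_fset n)[B BK Bn].
pose t := take n (enum_fset B).
have tn : size t = n by rewrite size_takel.
have ut : uniq t by rewrite take_uniq ?fset_uniq.
have tB i : i \in t ->
    (~` \bigcup_(y in Y) [set` supp (m y)]) i /\ i \notin supp l.
  by move=> /mem_take iB; have [? /negP] := BK i iB.
have [p pt cp] := cell_slice t wi fw.
have pn : size p = n by rewrite -tn -pt size_map.
have wflip i : i \in map fst p -> w \o flip i = w.
  rewrite pt => /tB[_ il]; rewrite -[RHS]/(b \*: step R l).
  by rewrite -(supported_flip (@step_supported R K l) il).
rewrite -pt in ut.
exists (L1_class mu (2 ^+ size p \*: (\1_(cell p) \* w))).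
  by split => //; rewrite /unit_ball /= (cell_norm wi ut wflip) w1.
move=> y Yy; set W := L1_class mu (2 ^+ _ \*: _).
pose g := @step R K (m y).
have gflip i : i \in map fst p -> g \o flip i = g.
  rewrite pt => /tB[iY _]; apply: (supported_flip (@step_supported R K (m y))).
  by apply/negP => im; apply: iY; exists y.
have := cell_norm_add wi (@step_integrable R K (m y)) ut wflip gflip.
rewrite -/W w1 pn.
have y1 : `|y| = 1 by exact: Y1.
have := ym y; rewrite -/g; set G := L1_class mu g => yG GW.
have GWy : `|G + W| <= `|y - G| + `|y + W| by exact: normD_swap.
have y1G : `|y| - `|G| <= `|y - G| by exact: lerB_dist.
have G1y : `|G| - `|y| <= `|y - G| by rewrite distrC; exact: lerB_dist.
have G2 : `|G| <= 2 by move: G1y yG d1; rewrite y1; clear; lra.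
have nG : 2^-1 ^+ n * `|G| <= e / 16 * 2 by apply: ler_pM; rewrite ?exprn_ge0.
move: G1y y1G GWy GW yG de d1 nG; rewrite y1; clear.
lra.
Qed.

Lemma L1_not_daugavet_property : infinite_set [set: K] ->
  ~ daugavet_property L1 K.
Proof.
move=> Kinf dau; pose u l : L1 := L1_class mu (@step R K l).
pose Y := (fun l => `|u l|^-1 *: u l) @` [set l | u l != 0].
have Y1 : Y `<=` unit_sphere (X := L1).
  move=> _ [l /= ul <-]; rewrite /unit_sphere /= normrZ normfV normr_id.
  by rewrite mulVf ?normr_eq0.
have YK : Y #<= [set: K].
  apply: card_le_trans (card_image_le _ _) _.
  apply: card_le_trans (card_leT _) _.
  apply: card_le_seq => //; apply: card_le_prod => //.
    exact: card_le_countType.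
  apply: card_le_seq => //; apply: card_le_prod => //.
  exact: card_le_countType.
(* The zero functional with [a = 1] cuts out the whole ball. *)
have ballS : is_slice (unit_ball (X := L1)).
  pose zero : {scalar L1} := (\0 : L1 -> R).
  exists zero, 1; split => //; first exact: cst_continuous.
  have -> : zero @` unit_ball (X := L1) = [set 0].
    apply/seteqP; split => [_ [x _ <-]//|_ ->]; exists 0 => //.
    by rewrite /unit_ball /= normr0.
  rewrite sup1 sub0r; apply/seteqP; split => [x x1|x []//].
  by split => //; rewrite oppr_lt0.
have [|x x1 xY] := dau Y Y1 YK _ ballS (2^-1); first by rewrite invr_gt0.
have [l xl] : exists l, `|- x - u l| < 8^-1.
  by apply: step_dense; rewrite invr_gt0.
(* For small [x] the constant 1 is a witness: [|1 + x| < 5/4 < 3/2]. Otherwise [u l] is nonzero, as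
   [1/8 < 1/4], and its normalisation lies within [1 - 1/4 + 2/8 = 1] of [- x]. *)
have [x4|x4] := ltP `|x| 4^-1.
  pose l1 := [:: (1, [::])] : seq (rat * seq (K * bool)).
  have u1 : `|u l1| = 1 by exact: L1_class_1.
  have /xY : Y (u l1).
    exists l1; last by rewrite u1 invr1 scale1r.
    by rewrite /= -normr_eq0 u1 oner_eq0.
  apply/negP; rewrite -leNgt (le_trans (ler_normD _ _))// u1.
  by move: x4; clear; lra.
have ul0 : u l != 0.
  apply/eqP => ul0; move: xl; rewrite ul0 subr0 normrN.
  by move: x4; clear; lra.
have /xY : Y (`|u l|^-1 *: u l) by exists l.
have := normalize_dist ul0 x1 xl; move: x4; clear; lra.
Qed.

End main.

Theorem theorem7p1 (R : realType) (K : choiceType)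
  (hK : infinite_set [set: K]) : is_Dau (L1_cube R K) K.
Proof.
split; first exact: L1_not_daugavet_property.
by move=> J nJ; apply: contrapT => nKJ; apply: nJ; exact: L1_daugavet_property.
Qed.
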